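(* Let $(M^n,g)$ be a Kähler manifold of complex dimension $n\ge 2$ and let $p\in M$. Suppose $(M,g)$ has nonnegative (resp. nonpositive) quadratic orthogonal bisectional curvature at $p$. Then the scalar curvature satisfies $S(p)\ge 0$ (resp. $S(p)\le 0$). Moreover, $S(p)=0$ if and only if for all unitary pairs $V,W\in T^{(1,0)}_p(M)$ we have $$R(V,\bar V,W,\bar W)=0\quad\text{and}\quad R(V,\bar V,V,\bar V)+R(W,\bar W,W,\bar W)=0.$$ If $n\ge 3$, then $S(p)=0$ also implies $R(V,\bar V,V,\bar V)=0$ for all $V\in T^{(1,0)}_p(M)$, and hence $M$ is flat at $p$ (the curvature tensor vanishes at $p$).
   Context: A Kähler manifold $(M,g)$ of complex dimension $n\ge 2$ has nonnegative (resp. nonpositive) quadratic orthogonal bisectional curvature (QOBC) at $p\in M$ if for every unitary frame $\{e_1,\dots,e_n\}$ of $T^{(1,0)}_p(M)$ and all real numbers $\xi_1,\dots,\xi_n$, $$\sum_{i,j=1}^n R_{i\bar i j\bar j}(\xi_i-\xi_j)^2\ge 0\quad(\text{resp. }\le 0),$$ where $R$ is the curvature tensor of $g$ and $R_{i\bar i j\bar j}=R(e_i,\bar e_i,e_j,\bar e_j)$, with the sign convention that $R(V,\bar V,V,\bar V)$ is the holomorphic sectional curvature for unit $V$ (positive for the Fubini–Study metric). A unitary pair is a pair of orthonormal vectors $V,W\in T^{(1,0)}_p(M)$ with respect to the Hermitian inner product induced by $g$. The scalar curvature is $S(p)=\sum_{i,j=1}^n R_{i\bar i j\bar j}$ for any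 unitary frame. *)

(* Defs.v *)
From HB Require Import structures.
From mathcomp Require Import all_boot all_order all_algebra.
From mathcomp Require Import sesquilinear spectral.
From mathcomp Require Import complex.
From mathcomp Require Import all_classical all_reals all_analysis.

Set Implicit Arguments.
Unset Strict Implicit.
Unset Printing Implicit Defensive.

Import Order.TTheory GRing.Theory Num.Theory.
Import numFieldNormedType.Exports.

Local Open Scope classical_set_scope.
Local Open Scope ring_scope.
Local Open Scope sesquilinear_scope.

(* R[i] with the topology and norm of a numFieldType, as a normed module over
   itself. *)
HB.instance Definition _ (R : realType) := NormedModule.copy R[i] R[i]^o.

(* The derivative of f : C^n -> C along v with respect to a real parameter,
   so that v and i * v are independent directions. *)
Definition real_derivable (R : realType) (n : nat) (v : 'rV[R[i]]_n)
    (f : 'rV[R[i]]_n -> R[i]) (z : 'rV[R[i]]_n) : Prop :=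
  derivable (fun t : R => complex.Re (f (z + (t%:C)%C *: v))) 0 1 /\
  derivable (fun t : R => complex.Im (f (z + (t%:C)%C *: v))) 0 1.

Definition real_derive (R : realType) (n : nat) (v : 'rV[R[i]]_n)
    (f : 'rV[R[i]]_n -> R[i]) (z : 'rV[R[i]]_n) : R[i] :=
  Complex ('D_1 (fun t : R => complex.Re (f (z + (t%:C)%C *: v))) 0)
          ('D_1 (fun t : R => complex.Im (f (z + (t%:C)%C *: v))) 0).

Fixpoint real_Ck (R : realType) (n k : nat) (U : set 'rV[R[i]]_n)
    (f : 'rV[R[i]]_n -> R[i]) : Prop :=
  {in U, continuous f} /\
  if k is k'.+1 then
    forall v : 'rV[R[i]]_n,
      (forall z, U z -> real_derivable v f z) /\ real_Ck k' U (real_derive v f)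
  else True.

Definition real_smooth (R : realType) (n : nat) (U : set 'rV[R[i]]_n)
    (f : 'rV[R[i]]_n -> R[i]) : Prop :=
  forall k : nat, real_Ck k U f.

(* The Wirtinger operators d/dz_k and d/dbar z_k; 'e_k is the k-th unit row. *)
Definition dz (R : realType) (n : nat) (k : 'I_n)
    (f : 'rV[R[i]]_n -> R[i]) (z : 'rV[R[i]]_n) : R[i] :=
  2^-1 * (real_derive 'e_k f z - 'i%C * real_derive ('i%C *: 'e_k) f z).

Definition dzbar (R : realType) (n : nat) (k : 'I_n)
    (f : 'rV[R[i]]_n -> R[i]) (z : 'rV[R[i]]_n) : R[i] :=
  2^-1 * (real_derive 'e_k f z + 'i%C * real_derive ('i%C *: 'e_k) f z).

(* A complex manifold of complex dimension n with a fixed holomorphic atlas.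
   The values of [chart a] and [chart_inv a] outside [chart_dom a] and its image
   are irrelevant. [differentiable] is taken over the field R[i]: for maps on an
   open set it means holomorphic. *)
Record complexManifold (R : realType) (n : nat) := ComplexManifold {
  cmfd_carrier :> topologicalType;
  cmfd_hausdorff : hausdorff_space cmfd_carrier;
  cmfd_second_countable : @second_countable cmfd_carrier;
  chart_index : Type;
  chart_dom : chart_index -> set cmfd_carrier;
  chart : chart_index -> cmfd_carrier -> 'rV[R[i]]_n;
  chart_inv : chart_index -> 'rV[R[i]]_n -> cmfd_carrier;
  chart_cover : forall p, exists a, chart_dom a p;
  chart_dom_open : forall a, open (chart_dom a);
  chart_image_open : forall a, open (chart a @` chart_dom a);
  chartK : forall a, {in chart_dom a, cancel (chart a) (chart_inv a)};
  chart_continuous : forall a, {in chart_dom a, continuous (chart a)};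
  chart_inv_continuous : forall a,
    {in chart a @` chart_dom a, continuous (chart_inv a)};
  chart_holomorphic : forall a b p, chart_dom a p -> chart_dom b p ->
    differentiable (chart b \o chart_inv a) (chart a p)
}.

(* A Kaehler metric, given in each chart by the Hermitian matrix
   g_{i bar j} = g(d/dz_i, d/dbar z_j). [kmetric_closed] is d omega = 0 for
   omega = sqrt(-1) * sum g_{i bar j} dz_i /\ dbar z_j. In [kmetric_compat],
   a row vector v of components in the chart a has components v *m J in b. *)
Record kahlerMetric (R : realType) (n : nat) (M : complexManifold R n) :=
  KahlerMetric {
  kmetric :> chart_index M -> 'rV[R[i]]_n -> 'M[R[i]]_n;
  kmetric_hermitian : forall (a : chart_index M) (p : M), chart_dom a p ->
    kmetric a (chart a p) \is hermsymmx;
  kmetric_posdef : forall (a : chart_index M) (p : M), chart_dom a p ->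
    forall v : 'rV[R[i]]_n, v != 0 ->
    0 < (v *m kmetric a (chart a p) *m v ^t* ) 0 0;
  kmetric_smooth : forall (a : chart_index M) (i j : 'I_n),
    real_smooth (chart a @` chart_dom a) (fun z => kmetric a z i j);
  kmetric_compat : forall (a b : chart_index M) (p : M),
    chart_dom a p -> chart_dom b p ->
    let J := 'J (chart b \o chart_inv a) (chart a p) in
    kmetric a (chart a p) = J *m kmetric b (chart b p) *m J ^t*;
  kmetric_closed : forall (a : chart_index M) (p : M), chart_dom a p ->
    forall i j k : 'I_n,
    dz k (fun z => kmetric a z i j) (chart a p) =
    dz i (fun z => kmetric a z k j) (chart a p)
}.

(* From here on, the space T^(1,0)_p(M) is identified with 'rV[R[i]]_n through
   the coordinate frame d/dz_1, ..., d/dz_n of a chart a around p. *)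
Definition hermprod (R : realType) (n : nat) (M : complexManifold R n)
    (g : kahlerMetric M) (a : chart_index M) (p : M) (V W : 'rV[R[i]]_n) :
    R[i] :=
  (V *m g a (chart a p) *m W ^t* ) 0 0.

(* R_{i bar j k bar l} = - d_k d_{bar l} g_{i bar j}
     + sum_{r, s} (d_k g_{i bar r}) g^{s bar r} (d_{bar l} g_{s bar j}),
   with (g^{s bar r})_{r, s} the inverse of the matrix (g_{s bar r})_{s, r};
   the sign makes the Fubini-Study metric positively curved. *)
Definition curv_coef (R : realType) (n : nat) (M : complexManifold R n)
    (g : kahlerMetric M) (a : chart_index M) (p : M) (i j k l : 'I_n) : R[i] :=
  let z := chart a p in
  - dz k (dzbar l (fun w => g a w i j)) z
  + \sum_(r < n) \sum_(s < n)
      dz k (fun w => g a w i r) z * invmx (g a z) r s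
      * dzbar l (fun w => g a w s j) z.

(* [curv g a p X Y Z W] is R(X, bar Y, Z, bar W). For a Kaehler metric these
   values determine the whole curvature tensor at p. *)
Definition curv (R : realType) (n : nat) (M : complexManifold R n)
    (g : kahlerMetric M) (a : chart_index M) (p : M)
    (X Y Z W : 'rV[R[i]]_n) : R[i] :=
  \sum_(i < n) \sum_(j < n) \sum_(k < n) \sum_(l < n)
    curv_coef g a p i j k l
    * X 0 i * (Y 0 j)^* * Z 0 k * (W 0 l)^*.

Definition unitary_pair (R : realType) (n : nat) (M : complexManifold R n)
    (g : kahlerMetric M) (a : chart_index M) (p : M) (V W : 'rV[R[i]]_n) :
    Prop :=
  [/\ hermprod g a p V V = 1, hermprod g a p W W = 1 & hermprod g a p V W = 0].

Definition unitary_frame (R : realType) (n : nat) (M : complexManifold R n)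
    (g : kahlerMetric M) (a : chart_index M) (p : M)
    (e : 'I_n -> 'rV[R[i]]_n) : Prop :=
  forall i j : 'I_n, hermprod g a p (e i) (e j) = (i == j)%:R.

(* In R[i], 0 <= x means that x is real and nonnegative. *)
Definition QOBC_form (R : realType) (n : nat) (M : complexManifold R n)
    (g : kahlerMetric M) (a : chart_index M) (p : M)
    (e : 'I_n -> 'rV[R[i]]_n) (xi : 'I_n -> R) : R[i] :=
  \sum_(i < n) \sum_(j < n)
    curv g a p (e i) (e i) (e j) (e j) * (((xi i - xi j) ^+ 2)%:C)%C.

Definition QOBC_ge0 (R : realType) (n : nat) (M : complexManifold R n)
    (g : kahlerMetric M) (a : chart_index M) (p : M) : Prop :=
  forall (e : 'I_n -> 'rV[R[i]]_n) (xi : 'I_n -> R),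
    unitary_frame g a p e -> 0 <= QOBC_form g a p e xi.

Definition QOBC_le0 (R : realType) (n : nat) (M : complexManifold R n)
    (g : kahlerMetric M) (a : chart_index M) (p : M) : Prop :=
  forall (e : 'I_n -> 'rV[R[i]]_n) (xi : 'I_n -> R),
    unitary_frame g a p e -> QOBC_form g a p e xi <= 0.

(* The common value of the double sum on all unitary frames. *)
Definition scalar_curvature (R : realType) (n : nat) (M : complexManifold R n)
    (g : kahlerMetric M) (a : chart_index M) (p : M) : R[i] :=
  xget 0 [set s : R[i] | forall e : 'I_n -> 'rV[R[i]]_n,
    unitary_frame g a p e ->
    s = \sum_(i < n) \sum_(j < n) curv g a p (e i) (e i) (e j) (e j)].

(* Main.v *)
Require Import Defs.
From HB Require Import structures.
From mathcomp Require Import all_boot all_order all_algebra.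
From mathcomp Require Import sesquilinear spectral.
From mathcomp Require Import complex.
From mathcomp Require Import all_classical all_reals all_analysis.
From mathcomp Require Import ring lra zify.

Set Implicit Arguments.
Unset Strict Implicit.
Unset Printing Implicit Defensive.

Import Order.TTheory GRing.Theory Num.Theory.
Import numFieldNormedType.Exports.

Local Open Scope ring_scope.

(** The statement concerns the curvature R(X, bar Y, Z, bar W) at [p] only
    through the algebra of a Kaehler curvature form ([kahler_form]): linear in
    X and Z, symmetric under exchange of X and Z, Hermitian. Fix a unitary
    frame e_1, ..., e_n, and write B(V, W) = R(V, bar V, W, bar W),
    H(V) = B(V, V) and Ric(V) = sum_j B(V, e_j); Ric and S = sum_i Ric(e_i) do
    not depend on the frame, being traces of sesquilinear forms
    ([sesquilinear_trace]).

    Expanding the squares, nonnegativity of the quadratic form with real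
    weights xi_i reads
      sum_{i,j} B(e_i, e_j) xi_i xi_j <= sum_i xi_i^2 Ric(e_i).
    Two choices of weights suffice.
    - A weight on one vector gives H(V) <= Ric(V) for unit V
      ([hsc_le_ricci_frame]).
    - Weights 1 and -1 on the rotated pair (V + W)/sqrt 2, (V - W)/sqrt 2 give
        2 B(V, W) + 2 Re R(V, bar W, V, bar W) <= Ric(V) + Ric(W)
      ([qobc_pair]). Replacing W by i W changes only the sign of the second
      term, so that 2 B(V, W) <= Ric(V) + Ric(W) for every unitary pair
      ([bisectional_le_ricci]).
    Summing the second inequality over all pairs of a frame yields
      0 <= sum_i (Ric(e_i) - H(e_i)) <= (n - 1) S
    ([defect_le_scal]), the left inequality being the first one. Hence S >= 0.

    If S = 0, then H = Ric on unit vectors, because every unit vector belongs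
    to a unitary frame ([hsc_eq_ricci]). Polarizing this identity gives
    4 B(V, W) = Ric(V) + Ric(W) on unitary pairs ([bisectional_eq_ricci]), and
    summing over the vectors W of a frame other than V gives (n - 2) Ric(V) = 0.
    For n >= 3 this kills Ric, hence H, hence R by polarization; for n = 2 one
    has Ric(V) + Ric(W) = S = 0 directly. In both cases B(V, W) = 0 and
    H(V) + H(W) = 0. The nonpositive case is the nonnegative one for -R.

    That the coordinate expression of the curvature is a Kaehler curvature form
    rests on d omega = 0 and on the equality of mixed partial derivatives
    ([schwarz_real]), which lets d/dz_k and d/dbar z_l commute. *)

(** * Mixed derivatives commute *)

Section MixedDerivatives.
Local Open Scope classical_set_scope.

(** The mean value theorem applied twice: first to the increment of [F] in its
    second argument as a function of the first, then to [F1 s]. *)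
Lemma mixed_difference (R : realType) (F F1 F12 : R -> R -> R) (r h : R) :
  (forall s t : R, `|s| < r -> `|t| < r -> is_derive s 1 (F^~ t) (F1 s t)) ->
  (forall s t : R, `|s| < r -> `|t| < r -> is_derive t 1 (F1 s) (F12 s t)) ->
  0 < h < r ->
  exists s t, [/\ 0 < s < h, 0 < t < h &
    F h h - F h 0 - F 0 h + F 0 0 = F12 s t * h * h].
Proof.
move=> dF dF1 /andP[h0 hr].
have small (x : R) : x \in `[0, h]%R -> `|x| < r.
  by rewrite in_itv /= => /andP[x0 xh]; rewrite ger0_norm// (le_lt_trans xh).
have smallo (x : R) : x \in `]0, h[%R -> `|x| < r.
  by move=> xh; apply: small; exact: subset_itv_oo_cc.
have h0' : `|0 : R| < r by apply: small; rewrite in_itv /= lexx ltW.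
have hh' : `|h| < r by apply: small; rewrite in_itv /= lexx ltW.
pose phi s := F s h - F s 0.
have dphi (s : R) : `|s| < r -> is_derive s 1 phi (F1 s h - F1 s 0).
  by move=> sr; apply: is_deriveB; exact: dF.
have [|s sh phiE] := MVT h0 (fun x xh => dphi x (smallo x xh)).
  apply: derivable_within_continuous => x /small xr.
  by have /@ex_derive := dphi x xr.
have [|t th psiE] := MVT h0 (fun x xh => dF1 s x (smallo _ sh) (smallo x xh)).
  apply: derivable_within_continuous => x /small xr.
  by have /@ex_derive := dF1 s x (smallo _ sh) xr.
exists s, t; split; [by move: sh; rewrite in_itv|by move: th; rewrite in_itv|].
by move: phiE; rewrite psiE /phi !subr0 => <-; ring.
Qed.

(** The second difference over a square is symmetric in the two variables, so
    by [mixed_difference] each mixed derivative takes a common value somewhere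
    in any small square; continuity at the corner concludes. *)
Lemma schwarz_real (R : realType) (F F1 F2 F12 F21 : R -> R -> R) (r : R) :
  0 < r ->
  (forall s t : R, `|s| < r -> `|t| < r -> is_derive s 1 (F^~ t) (F1 s t)) ->
  (forall s t : R, `|s| < r -> `|t| < r -> is_derive t 1 (F1 s) (F12 s t)) ->
  (forall s t : R, `|s| < r -> `|t| < r -> is_derive t 1 (F s) (F2 s t)) ->
  (forall s t : R, `|s| < r -> `|t| < r -> is_derive s 1 (F2^~ t) (F21 s t)) ->
  {for (0, 0), continuous (fun q => F12 q.1 q.2)} ->
  {for (0, 0), continuous (fun q => F21 q.1 q.2)} ->
  F12 0 0 = F21 0 0.
Proof.
move=> r0 dF dF1 dF' dF2 c12 c21.
apply/eqP; rewrite -subr_eq0 -normr_le0; apply/ler_addgt0Pr => e e0.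
rewrite add0r.
have e2 : 0 < e / 2 by rewrite divr_gt0.
have nb (G : R -> R -> R) : {for (0, 0), continuous (fun q => G q.1 q.2)} ->
    exists2 d, 0 < d &
      forall s t, `|s| < d -> `|t| < d -> `|G 0 0 - G s t| < e / 2.
  move=> /cvgrPdist_lt /(_ _ e2) [[A B]].
  move=> [/= /nbhs_ballP[d1 /= d10 A1] /nbhs_ballP[d2 /= d20 B2]] AB.
  exists (Num.min d1 d2); first by rewrite lt_min d10.
  move=> s t; rewrite !lt_min => /andP[s1 s2] /andP[t1 t2].
  apply: (AB (s, t)); split => /=; [apply: A1|apply: B2];
    by rewrite /ball /= sub0r normrN.
have [d1 d10 c1] := nb _ c12; have [d2 d20 c2] := nb _ c21.
pose h := Num.min r (Num.min d1 d2) / 2.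
have m0 : 0 < Num.min r (Num.min d1 d2) by rewrite !lt_min r0 d10.
have h0 : 0 < h by rewrite divr_gt0.
have : h < Num.min r (Num.min d1 d2) by rewrite /h; lra.
rewrite !lt_min => /and3P[hr hd1 hd2].
have [|s [t [sh th E1]]] := mixed_difference (h := h) dF dF1; first by rewrite h0.
have [|t' [s' [sh' th' E2]]] := mixed_difference (h := h) (r := r)
  (F := fun t s => F s t) (F1 := fun t s => F2 s t) (F12 := fun t s => F21 s t)
  (fun t s tr sr => dF' s t sr tr) (fun t s tr sr => dF2 s t sr tr).
  by rewrite h0.
have E : F12 s t = F21 s' t'.
  apply: (mulIf (lt0r_neq0 h0)); apply: (mulIf (lt0r_neq0 h0)).
  by rewrite -E1 -E2; ring.
have lt_norm (x d : R) : 0 < x < h -> h < d -> `|x| < d.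
  by move=> /andP[x0 xh] hd; rewrite gtr0_norm// (lt_trans xh).
have B1 : `|F12 0 0 - F12 s t| < e / 2.
  by apply: c1; [exact: (lt_norm _ _ sh hd1)|exact: (lt_norm _ _ th hd1)].
have B2 : `|F21 0 0 - F21 s' t'| < e / 2.
  by apply: c2; [exact: (lt_norm _ _ th' hd2)|exact: (lt_norm _ _ sh' hd2)].
have -> : F12 0 0 - F21 0 0 = (F12 0 0 - F12 s t) - (F21 0 0 - F21 s' t').
  by rewrite E; ring.
by apply: (le_trans (ler_normB _ _)); rewrite (splitr e) lerD// ltW.
Qed.

Lemma real_complex_continuous (R : realType) :
  continuous (fun t : R => (t%:C)%C : R[i]).
Proof.
move=> t; apply/cvgrPdist_lt => /= e e0.
have: 0 < complex.Re e by move: e0; rewrite ltcE => /andP[].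
move=> e0'; near=> s.
rewrite -rmorphB normc_def /= expr0n addr0 sqrtr_sqr.
rewrite ltcE /=; apply/andP; split.
  by move: e0; rewrite ltcE => /andP[/eqP ->].
near: s. apply: cvgr_dist_lt => //; exact: cvg_id.
Unshelve. all: by end_near. Qed.

Lemma Re_continuous (R : realType) : continuous (@complex.Re R : R[i] -> R).
Proof.
move=> x; apply/(@cvgrPdist_lt _ _ _ (nbhs x)) => /= e e0.
near=> y.
have: `|x - y| < (e%:C)%C.
  near: y; apply: nbhsx_ballx; by rewrite ltcE /= eqxx.
move=> h; have := le_lt_trans (normc_ge_Re _) h.
by rewrite ltcE /= eqxx /= raddfB.
Unshelve. all: by end_near. Qed.

Lemma Im_continuous (R : realType) : continuous (@complex.Im R : R[i] -> R).
Proof.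
have -> : (@complex.Im R : R[i] -> R) = fun x => complex.Re (- 'i%C * x).
  by apply/funext => -[u v] /=; rewrite !(mul0r, mulN1r,oppr0,sub0r, opprK).
move=> x; apply: (@continuous_comp _ _ _ (fun x : R[i] => - 'i%C * x)).
  by apply: (@mulrl_continuous R[i]).
exact: Re_continuous.
Qed.

Lemma plane_continuous (R : realType) n (z u v : 'rV[R[i]]_n) :
  continuous (fun q : R * R => z + (q.1%:C)%C *: u + (q.2%:C)%C *: v).
Proof.
move=> q; apply: cvgD; first apply: cvgD; first exact: cvg_cst.
  apply: cvgZ; last exact: cvg_cst.
  apply: (@cvg_comp _ _ _ fst (fun t : R => (t%:C)%C : R[i])); first exact: cvg_fst.
  exact: real_complex_continuous.
  apply: cvgZ; last exact: cvg_cst.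
  apply: (@cvg_comp _ _ _ snd (fun t : R => (t%:C)%C : R[i])); first exact: cvg_snd.
  exact: real_complex_continuous.
Qed.

(** The real and the imaginary part of [real_derive] are real directional
    derivatives, to which real calculus applies one at a time. *)
Definition dir_derive (R : realType) n (v : 'rV[R[i]]_n) (k : 'rV[R[i]]_n -> R)
  (z : 'rV[R[i]]_n) : R := 'D_1 (fun t : R => k (z + (t%:C)%C *: v)) 0.

Definition dir_derivable (R : realType) n (v : 'rV[R[i]]_n)
  (k : 'rV[R[i]]_n -> R) (z : 'rV[R[i]]_n) : Prop :=
  derivable (fun t : R => k (z + (t%:C)%C *: v)) 0 1.

Lemma is_derive_line (R : realType) n (v : 'rV[R[i]]_n) (k : 'rV[R[i]]_n -> R)
    (z : 'rV[R[i]]_n) (s : R) :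
  dir_derivable v k (z + (s%:C)%C *: v) ->
  is_derive s 1 (fun t : R => k (z + (t%:C)%C *: v))
    (dir_derive v k (z + (s%:C)%C *: v)).
Proof.
move=> kv.
(* The difference quotients at [s] along the line through [z] and at [0] along
   the line through the point with parameter [s] are the same function. *)
have E :
  (fun h : R => h^-1 *: (((fun t : R => k (z + (t%:C)%C *: v)) \o shift s) (h *: 1)
     - k (z + (s%:C)%C *: v))) =
  (fun h : R => h^-1 *: (((fun t : R =>
     k (z + (s%:C)%C *: v + (t%:C)%C *: v)) \o shift 0) (h *: 1)
     - k (z + (s%:C)%C *: v + (0%:C)%C *: v))).
  have A (x : R) : z + ((x + s)%:C)%C *: v =
      z + (s%:C)%C *: v + ((x + 0)%:C)%C *: v.
    by rewrite addr0 -addrA -scalerDl -rmorphD [s + x]addrC.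
  by apply/funext => h; rewrite !compE /shift A scale0r !addr0.
by apply: DeriveDef; rewrite ?/dir_derive /derivable /derive E.
Qed.

Lemma schwarz_dir (R : realType) n (U : set 'rV[R[i]]_n) (u v z : 'rV[R[i]]_n)
    (k : 'rV[R[i]]_n -> R) : open U -> U z ->
  (forall w, U w -> dir_derivable u k w) ->
  (forall w, U w -> dir_derivable v k w) ->
  (forall w, U w -> dir_derivable v (dir_derive u k) w) ->
  (forall w, U w -> dir_derivable u (dir_derive v k) w) ->
  {for z, continuous (dir_derive v (dir_derive u k))} ->
  {for z, continuous (dir_derive u (dir_derive v k))} ->
  dir_derive v (dir_derive u k) z = dir_derive u (dir_derive v k) z.
Proof.
move=> oU Uz ku kv kuv kvu cuv cvu.
pose P (q : R * R) := z + (q.1%:C)%C *: u + (q.2%:C)%C *: v.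
have P0 : P (0, 0) = z by rewrite /P /= !scale0r !addr0.
have cP : {for (0, 0), continuous P} by apply: plane_continuous.
have [r r0 rU] : exists2 r : R, 0 < r &
    forall s t : R, `|s| < r -> `|t| < r -> U (P (s, t)).
  have : nbhs (P (0, 0)) U by rewrite P0; apply: open_nbhs_nbhs.
  move=> /cP [[A B] [/= /nbhs_ballP[d1 /= d10 A1]]].
  move=> /nbhs_ballP[d2 /= d20 B2] AB.
  exists (Num.min d1 d2); first by rewrite lt_min d10.
  move=> s t; rewrite !lt_min => /andP[s1 s2] /andP[t1 t2].
  by apply: (AB (s, t)); split => /=; [apply: A1|apply: B2];
    rewrite /ball /= sub0r normrN.
have cc (G : 'rV[R[i]]_n -> R) : {for z, continuous G} ->
    {for (0, 0), continuous (fun q : R * R => G (P (q.1, q.2)))}.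
  move=> cG; have -> : (fun q : R * R => G (P (q.1, q.2))) = G \o P.
    by apply/funext => -[].
  by apply: continuous_comp => //; rewrite P0.
have flip s t : P (s, t) = z + (t%:C)%C *: v + (s%:C)%C *: u by rewrite /P addrAC.
rewrite -P0.
apply: (@schwarz_real R (fun s t => k (P (s, t))) (fun s t => dir_derive u k (P (s, t)))
  (fun s t => dir_derive v k (P (s, t)))
  (fun s t => dir_derive v (dir_derive u k) (P (s, t)))
  (fun s t => dir_derive u (dir_derive v k) (P (s, t))) r).
- exact: r0.
- move=> s t sr tr.
  rewrite (_ : (fun _ => _) = fun s => k (z + (t%:C)%C *: v + (s%:C)%C *: u));
    last by apply/funext => x; rewrite flip.
  by rewrite flip; apply: is_derive_line; rewrite -flip; apply/ku/rU.
- by move=> s t sr tr; exact: (is_derive_line (kuv _ (rU s t sr tr))).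
- by move=> s t sr tr; exact: (is_derive_line (kv _ (rU s t sr tr))).
- move=> s t sr tr.
  rewrite (_ : (fun _ => _) = fun s =>
      dir_derive v k (z + (t%:C)%C *: v + (s%:C)%C *: u));
    last by apply/funext => x; rewrite flip.
  by rewrite flip; apply: is_derive_line; rewrite -flip; apply/kvu/rU.
- exact: cc cuv.
- exact: cc cvu.
Qed.

Lemma real_derivableE (R : realType) n (v : 'rV[R[i]]_n) f z :
  real_derivable v f z = (dir_derivable v (@complex.Re R \o f) z /\
                          dir_derivable v (@complex.Im R \o f) z).
Proof. by []. Qed.

Lemma real_deriveE (R : realType) n (v : 'rV[R[i]]_n) f z :
  real_derive v f z = Complex (dir_derive v (@complex.Re R \o f) z)
                              (dir_derive v (@complex.Im R \o f) z).
Proof. by []. Qed.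

Lemma real_derive_comm (R : realType) n (U : set 'rV[R[i]]_n)
    (u v z : 'rV[R[i]]_n) (f : 'rV[R[i]]_n -> R[i]) : open U -> U z -> real_Ck 2 U f ->
  real_derive v (real_derive u f) z = real_derive u (real_derive v f) z.
Proof.
move=> oU Uz [_ C1].
have [du [_ C2u]] := C1 u; have [dv [_ C2v]] := C1 v.
have [duv [cuv _]] := C2u v; have [dvu [cvu _]] := C2v u.
have zU : z \in U by exact: mem_set.
have {}cuv : {for z, continuous (real_derive v (real_derive u f))} := cuv _ zU.
have {}cvu : {for z, continuous (real_derive u (real_derive v f))} := cvu _ zU.
have ReD w g : @complex.Re R \o real_derive w g = dir_derive w (@complex.Re R \o g).
  by [].
have ImD w g : @complex.Im R \o real_derive w g = dir_derive w (@complex.Im R \o g).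
  by [].
rewrite !real_deriveE !ReD !ImD.
rewrite (schwarz_dir (k := @complex.Re R \o f) oU Uz).
- rewrite (schwarz_dir (k := @complex.Im R \o f) oU Uz) //.
  + by move=> w /du; rewrite real_derivableE => -[_ H]; exact: H.
  + by move=> w /dv; rewrite real_derivableE => -[_ H]; exact: H.
  + by move=> w /duv; rewrite real_derivableE ImD => -[_ H]; exact: H.
  + by move=> w /dvu; rewrite real_derivableE ImD => -[_ H]; exact: H.
  + rewrite -!ImD; apply: continuous_comp; [exact: cuv|exact: Im_continuous].
  + rewrite -!ImD; apply: continuous_comp; [exact: cvu|exact: Im_continuous].
- by move=> w /du; rewrite real_derivableE => -[H _]; exact: H.
- by move=> w /dv; rewrite real_derivableE => -[H _]; exact: H.
- by move=> w /duv; rewrite real_derivableE ReD => -[H _]; exact: H.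
- by move=> w /dvu; rewrite real_derivableE ReD => -[H _]; exact: H.
- rewrite -!ReD; apply: continuous_comp; [exact: cuv|exact: Re_continuous].
- rewrite -!ReD; apply: continuous_comp; [exact: cvu|exact: Re_continuous].
Qed.

(** * Rules for real derivatives and the Wirtinger operators *)

Lemma line_in_open (R : realType) n (U : set 'rV[R[i]]_n) (z v : 'rV[R[i]]_n) :
  open U -> U z -> \forall t \near (0 : R), U (z + (t%:C)%C *: v).
Proof.
move=> oU Uz.
have cP : {for (0 : R), continuous (fun t : R => z + (t%:C)%C *: v)}.
  apply: cvgD; first exact: cvg_cst.
  apply: cvgZ; last exact: cvg_cst.
  exact: real_complex_continuous.
apply: cP; rewrite /= scale0r addr0; exact: open_nbhs_nbhs.
Qed.

Lemma real_derive_eq_on (R : realType) n (U : set 'rV[R[i]]_n) (z v : 'rV[R[i]]_n)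
    (f g : 'rV[R[i]]_n -> R[i]) :
  open U -> U z -> (forall w, U w -> f w = g w) ->
  real_derive v f z = real_derive v g z.
Proof.
move=> oU Uz fg; rewrite !real_deriveE.
have E (k : R[i] -> R) : dir_derive v (k \o f) z = dir_derive v (k \o g) z.
  apply: near_eq_derive; near=> t.
  by rewrite /= fg//; near: t; exact: line_in_open.
by rewrite !E.
Unshelve. all: by end_near. Qed.

Lemma derive_lincomb (R : realType) (A B : R -> R) (c d t : R) :
  derivable A t 1 -> derivable B t 1 ->
  derivable (fun x => c * A x + d * B x) t 1 /\
  'D_1 (fun x => c * A x + d * B x) t = c * 'D_1 A t + d * 'D_1 B t.
Proof.
move=> dA dB.
have H : is_derive t 1 (c *: A + d *: B) (c *: 'D_1 A t + d *: 'D_1 B t).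
  have := derivableP dA; have := derivableP dB => ? ?.
  by apply: is_deriveD.
by split; [exact: (@ex_derive _ _ _ _ _ _ _ H)|exact: (@derive_val _ _ _ _ _ _ _ H)].
Qed.

Lemma mul_complexE (R : realType) (x y : R[i]) :
  x * y = Complex (complex.Re x * complex.Re y - complex.Im x * complex.Im y)
                  (complex.Re x * complex.Im y + complex.Im x * complex.Re y).
Proof. by case: x y => [a b] [c d]. Qed.

Lemma real_derivableZ (R : realType) n (z v : 'rV[R[i]]_n) (c : R[i])
    (f : 'rV[R[i]]_n -> R[i]) :
  real_derivable v f z ->
  real_derivable v (fun w => c * f w) z /\
  real_derive v (fun w => c * f w) z = c * real_derive v f z.
Proof.
rewrite !real_derivableE !real_deriveE => -[fR fI].
have ER : (fun t : R => (@complex.Re R \o (fun w => c * f w)) (z + (t%:C)%C *: v)) =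
   (fun t => complex.Re c * (@complex.Re R \o f) (z + (t%:C)%C *: v) +
     (- complex.Im c) * (@complex.Im R \o f) (z + (t%:C)%C *: v)).
  by apply/funext => t; rewrite !compE mul_complexE [LHS]/= mulNr.
have EI : (fun t : R => (@complex.Im R \o (fun w => c * f w)) (z + (t%:C)%C *: v)) =
   (fun t => complex.Re c * (@complex.Im R \o f) (z + (t%:C)%C *: v) +
     complex.Im c * (@complex.Re R \o f) (z + (t%:C)%C *: v)).
  by apply/funext => t; rewrite !compE mul_complexE.
have [dR eR] := derive_lincomb (complex.Re c) (- complex.Im c) fR fI.
have [dI eI] := derive_lincomb (complex.Re c) (complex.Im c) fI fR.
split; first by split; rewrite /dir_derivable ?ER ?EI; [exact: dR|exact: dI].
rewrite {1 2}/dir_derive ER EI eR eI.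
by rewrite [RHS]mul_complexE mulNr.
Qed.

Lemma real_derivableD (R : realType) n (z v : 'rV[R[i]]_n)
    (f g : 'rV[R[i]]_n -> R[i]) :
  real_derivable v f z -> real_derivable v g z ->
  real_derivable v (fun w => f w + g w) z /\
  real_derive v (fun w => f w + g w) z = real_derive v f z + real_derive v g z.
Proof.
rewrite !real_derivableE !real_deriveE => -[fR fI] [gR gI].
have ER : (fun t : R => (@complex.Re R \o (fun w => f w + g w)) (z + (t%:C)%C *: v)) =
   (fun t => 1 * (@complex.Re R \o f) (z + (t%:C)%C *: v) +
     1 * (@complex.Re R \o g) (z + (t%:C)%C *: v)).
  by apply/funext => t; rewrite !compE !mul1r raddfD.
have EI : (fun t : R => (@complex.Im R \o (fun w => f w + g w)) (z + (t%:C)%C *: v)) =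
   (fun t => 1 * (@complex.Im R \o f) (z + (t%:C)%C *: v) +
     1 * (@complex.Im R \o g) (z + (t%:C)%C *: v)).
  by apply/funext => t; rewrite !compE !mul1r raddfD.
have [dR eR] := derive_lincomb 1 1 fR gR.
have [dI eI] := derive_lincomb 1 1 fI gI.
split; first by split; rewrite /dir_derivable ?ER ?EI; [exact: dR|exact: dI].
by rewrite {1 2}/dir_derive ER EI eR eI !mul1r.
Qed.

Lemma real_derivable_conj (R : realType) n (z v : 'rV[R[i]]_n)
    (f : 'rV[R[i]]_n -> R[i]) :
  real_derivable v f z ->
  real_derive v (fun w => (f w)^* ) z = (real_derive v f z)^*.
Proof.
rewrite !real_derivableE !real_deriveE => -[fR fI].
have ER : (fun t : R => (@complex.Re R \o (fun w => (f w)^* )) (z + (t%:C)%C *: v)) =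
   (fun t => (@complex.Re R \o f) (z + (t%:C)%C *: v)).
  by apply/funext => t; rewrite !compE; case: (f _).
have EI : (fun t : R => (@complex.Im R \o (fun w => (f w)^* )) (z + (t%:C)%C *: v)) =
   (fun t => (-1) * (@complex.Im R \o f) (z + (t%:C)%C *: v) +
     0 * (@complex.Im R \o f) (z + (t%:C)%C *: v)).
  by apply/funext => t; rewrite !compE; case: (f _) => x y /=; rewrite mulN1r mul0r addr0.
have [dI eI] := derive_lincomb (-1) 0 fI fI.
by rewrite {1 2}/dir_derive ER EI eI mulN1r mul0r addr0.
Qed.

(** Both Wirtinger operators have this shape, [dz] with s = -i and [dzbar] with
    s = i; their commutation and conjugation rules are proved once for it. *)
Definition wirtinger (R : realType) n (s : R[i]) (u v : 'rV[R[i]]_n)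
    (f : 'rV[R[i]]_n -> R[i]) (z : 'rV[R[i]]_n) : R[i] :=
  2^-1 * (real_derive u f z + s * real_derive v f z).

Lemma dzE (R : realType) n (k : 'I_n) (f : 'rV[R[i]]_n -> R[i]) :
  dz k f = wirtinger (- 'i%C) 'e_k ('i%C *: 'e_k) f.
Proof. by apply/funext => z; rewrite /dz /wirtinger mulNr. Qed.

Lemma dzbarE (R : realType) n (k : 'I_n) (f : 'rV[R[i]]_n -> R[i]) :
  dzbar k f = wirtinger 'i%C 'e_k ('i%C *: 'e_k) f.
Proof. by []. Qed.

Lemma wirtinger_eq_on (R : realType) n (U : set 'rV[R[i]]_n) s
    (u v z : 'rV[R[i]]_n) (f g : 'rV[R[i]]_n -> R[i]) :
  open U -> U z -> (forall w, U w -> f w = g w) ->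
  wirtinger s u v f z = wirtinger s u v g z.
Proof.
move=> oU Uz fg.
by rewrite /wirtinger !(real_derive_eq_on _ oU Uz fg).
Qed.

(** Wirtinger derivatives of functions with second derivatives can be
    differentiated term by term. *)
Lemma real_derive_wirtinger (R : realType) n s (u v w z : 'rV[R[i]]_n)
    (f : 'rV[R[i]]_n -> R[i]) :
  real_derivable w (real_derive u f) z -> real_derivable w (real_derive v f) z ->
  real_derivable w (wirtinger s u v f) z /\
  real_derive w (wirtinger s u v f) z =
  2^-1 * (real_derive w (real_derive u f) z + s * real_derive w (real_derive v f) z).
Proof.
move=> du /(real_derivableZ s)[dv <-].
have [d <-] := real_derivableD du dv.
exact: real_derivableZ.
Qed.

Lemma wirtinger_comm (R : realType) n (U : set 'rV[R[i]]_n) s s'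
    (u v u' v' z : 'rV[R[i]]_n) (f : 'rV[R[i]]_n -> R[i]) :
  open U -> U z -> real_Ck 2 U f ->
  wirtinger s u v (wirtinger s' u' v' f) z =
  wirtinger s' u' v' (wirtinger s u v f) z.
Proof.
move=> oU Uz f2.
have dd w w' : real_derivable w (real_derive w' f) z.
  by case: f2 => _ /(_ w')[_ [_ /(_ w)[/(_ z Uz)]]].
rewrite {1}/wirtinger [RHS]/wirtinger.
rewrite !(real_derive_wirtinger _ (dd _ _) (dd _ _)).2.
rewrite (real_derive_comm u' u oU Uz f2) (real_derive_comm u' v oU Uz f2).
rewrite (real_derive_comm v' u oU Uz f2) (real_derive_comm v' v oU Uz f2).
have swap (C : comPzRingType) (h x y a b c d : C) :
    h * (h * (a + y * b) + x * (h * (c + y * d))) =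
    h * (h * (a + x * c) + y * (h * (b + x * d))) by ring.
exact: swap.
Qed.

Lemma wirtinger_conj (R : realType) n s (u v z : 'rV[R[i]]_n)
    (f : 'rV[R[i]]_n -> R[i]) :
  real_derivable u f z -> real_derivable v f z ->
  wirtinger s u v (fun w => (f w)^* ) z = (wirtinger s^* u v f z)^*.
Proof.
move=> du dv.
rewrite /wirtinger (real_derivable_conj du) (real_derivable_conj dv).
rewrite [RHS]rmorphM [in RHS]rmorphD [in RHS]rmorphM.
by rewrite [X in _ = _ * (_ + X * _)](conjCK s) fmorphV rmorph_nat.
Qed.

Lemma dzbar_conj (R : realType) n (k : 'I_n) (z : 'rV[R[i]]_n)
    (f : 'rV[R[i]]_n -> R[i]) : (forall v, real_derivable v f z) ->
  dzbar k (fun w => (f w)^* ) z = (dz k f z)^*.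
Proof.
move=> df; rewrite dzE dzbarE wirtinger_conj//.
congr (wirtinger _ _ _ _ _)^*.
by apply/eqP; rewrite eq_complex /= oppr0 !eqxx.
Qed.

Lemma dz_dzbar_comm (R : realType) n (U : set 'rV[R[i]]_n) (k l : 'I_n)
    (z : 'rV[R[i]]_n) (f : 'rV[R[i]]_n -> R[i]) :
  open U -> U z -> real_Ck 2 U f -> dz k (dzbar l f) z = dzbar l (dz k f) z.
Proof. by move=> oU Uz f2; rewrite !dzE !dzbarE; exact: wirtinger_comm f2. Qed.

Lemma conj_invmx (R : realType) m (A : 'M[R[i]]_m) (i j : 'I_m) :
  (forall i j, (A i j)^* = A j i) -> (invmx A i j)^* = invmx A j i.
Proof.
move=> hA; have -> : (invmx A i j)^* = map_mx Num.conj (invmx A) i j by rewrite mxE.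
rewrite map_invmx (_ : map_mx _ A = A^T) -?trmx_inv ?mxE//.
by apply/matrixP => r s; rewrite !mxE; exact: hA.
Qed.

End MixedDerivatives.

(** * Symmetries of the curvature coefficients *)

Section CurvatureSymmetries.
Local Open Scope classical_set_scope.
Variables (R : realType) (n : nat) (M : complexManifold R n) (g : kahlerMetric M).
Variables (a : chart_index M) (p : M).
Hypothesis ap : chart_dom a p.

Local Notation U := (chart a @` chart_dom a).

Let oU : open U. Proof. exact: chart_image_open. Qed.

Let Up : U (chart a p). Proof. by exists p. Qed.

Lemma kmetric_Ck k (i j : 'I_n) : real_Ck k U (fun z => g a z i j).
Proof. exact: kmetric_smooth. Qed.

Lemma kmetric_derivable (i j : 'I_n) v z : U z ->
  real_derivable v (fun w => g a w i j) z.
Proof. by move=> Uz; have [_ /(_ v)[+ _]] := kmetric_Ck 1 i j; apply. Qed.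

Lemma kmetric_conj (i j : 'I_n) z : U z -> (g a z i j)^* = g a z j i.
Proof.
move=> [q aq <-]; have /is_hermitianmxP := kmetric_hermitian g aq.
by rewrite expr0 scale1r => /matrixP/(_ j i); rewrite !mxE.
Qed.

Lemma dz_kmetric_sym (i j k : 'I_n) z : U z ->
  dz k (fun w => g a w i j) z = dz i (fun w => g a w k j) z.
Proof. by move=> [q aq <-]; exact: kmetric_closed. Qed.

Lemma dz_kmetric_conj (k i j : 'I_n) z : U z ->
  (dz k (fun w => g a w i j) z)^* = dzbar k (fun w => g a w j i) z.
Proof.
move=> Uz; rewrite -dzbar_conj; last by move=> v; exact: kmetric_derivable.
by rewrite !dzbarE; apply: (wirtinger_eq_on _ _ _ oU Uz) => w; exact: kmetric_conj.
Qed.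

Lemma dzbar_kmetric_conj (k i j : 'I_n) z : U z ->
  (dzbar k (fun w => g a w i j) z)^* = dz k (fun w => g a w j i) z.
Proof. by move=> Uz; rewrite -dz_kmetric_conj// conjCK. Qed.

(** Moving [dz k] inside [dzbar l] makes d omega = 0 applicable. It holds on the
    whole image of the chart, which is what differentiating it requires. *)
Lemma dz_dzbar_kmetric_sym (i j k l : 'I_n) :
  dz k (dzbar l (fun w => g a w i j)) (chart a p) =
  dz i (dzbar l (fun w => g a w k j)) (chart a p).
Proof.
rewrite (dz_dzbar_comm k l oU Up (kmetric_Ck 2 i j)).
rewrite (dz_dzbar_comm i l oU Up (kmetric_Ck 2 k j)) !dzbarE.
by apply: (wirtinger_eq_on _ _ _ oU Up) => w Uw; exact: dz_kmetric_sym.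
Qed.

Lemma curv_coef_sym (i j k l : 'I_n) :
  curv_coef g a p i j k l = curv_coef g a p k j i l.
Proof.
rewrite /curv_coef dz_dzbar_kmetric_sym; apply: congr1.
by apply: eq_bigr => r _; apply: eq_bigr => s _; rewrite dz_kmetric_sym.
Qed.

Lemma dzbar_kmetric_derivable (i j k : 'I_n) v z : U z ->
  real_derivable v (dzbar k (fun w => g a w i j)) z.
Proof.
move=> Uz; have [_ C1] := kmetric_Ck 2 i j.
have dd w : real_derivable v (real_derive w (fun w => g a w i j)) z.
  by have [_ [_ /(_ v)[+ _]]] := C1 w; apply.
by have [] := real_derive_wirtinger 'i%C (dd 'e_k) (dd ('i%C *: 'e_k)).
Qed.

Lemma dz_dzbar_kmetric_conj (i j k l : 'I_n) :
  (dz k (dzbar l (fun w => g a w i j)) (chart a p))^* =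
  dz l (dzbar k (fun w => g a w j i)) (chart a p).
Proof.
rewrite -dzbar_conj; last by move=> v; exact: dzbar_kmetric_derivable.
rewrite (dz_dzbar_comm l k oU Up (kmetric_Ck 2 j i)) !dzbarE.
by apply: (wirtinger_eq_on _ _ _ oU Up) => w Uw; exact: dzbar_kmetric_conj.
Qed.

(** Conjugation exchanges [dz] with [dzbar] and transposes the metric and its
    inverse, so the two terms of the curvature are separately Hermitian. *)
Lemma curv_coef_conj (i j k l : 'I_n) :
  (curv_coef g a p i j k l)^* = curv_coef g a p j i l k.
Proof.
rewrite /curv_coef [LHS]rmorphD [in LHS]rmorphN.
rewrite [X in - X](dz_dzbar_kmetric_conj i j k l).
apply: congr1.
rewrite [LHS]rmorph_sum exchange_big; apply: eq_bigr => s _.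
rewrite [LHS]rmorph_sum; apply: eq_bigr => r _.
have conjM3 (C : numClosedFieldType) (x y w : C) : (x * y * w)^* = w^* * y^* * x^*.
  by rewrite !rmorphM /=; ring.
rewrite [LHS]conjM3 dz_kmetric_conj// dzbar_kmetric_conj//.
by rewrite (conj_invmx s r (fun _ _ => kmetric_conj _ _ Up)).
Qed.

End CurvatureSymmetries.

(** * Unitary frames *)

Section HermitianFrames.
Local Open Scope sesquilinear_scope.
Variables (C : numClosedFieldType) (n : nat) (G : 'M[C]_n).
Implicit Types X Y : 'rV[C]_n.

Definition hdot X Y : C := (X *m G *m Y ^t* ) 0 0.

Definition orthonormal_frame (e : 'I_n -> 'rV[C]_n) : Prop :=
  forall i j, hdot (e i) (e j) = (i == j)%:R.

Lemma hdotDl X X' Y : hdot (X + X') Y = hdot X Y + hdot X' Y.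
Proof. by rewrite /hdot !mulmxDl mxE. Qed.

Lemma hdotZl a X Y : hdot (a *: X) Y = a * hdot X Y.
Proof. by rewrite /hdot -!scalemxAl mxE. Qed.

Hypothesis G_conj : forall i j, (G i j)^* = G j i.
Hypothesis G_pos : forall X, X != 0 -> 0 < hdot X X.

Lemma hdot_conj X Y : (hdot X Y)^* = hdot Y X.
Proof.
have E Z W : hdot Z W = \sum_j \sum_i Z 0 i * G i j * (W 0 j)^*.
  by rewrite /hdot mxE; apply: eq_bigr => j _; rewrite !mxE mulr_suml.
rewrite !E rmorph_sum exchange_big; apply: eq_bigr => j _ /=.
rewrite rmorph_sum; apply: eq_bigr => i _.
by rewrite !rmorphM /= conjCK G_conj; ring.
Qed.

Lemma hdotDr X Y Y' : hdot X (Y + Y') = hdot X Y + hdot X Y'.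
Proof. by rewrite -hdot_conj hdotDl rmorphD /= !hdot_conj. Qed.

Lemma hdotZr a X Y : hdot X (a *: Y) = a^* * hdot X Y.
Proof. by rewrite -hdot_conj hdotZl rmorphM /= !hdot_conj. Qed.

(** With F the matrix of rows e_k, orthonormality says that F G F^t* is the
    identity; a one-sided inverse of a square matrix is two-sided. *)
Lemma frame_expand e X : orthonormal_frame e ->
  X = \sum_k hdot X (e k) *: e k.
Proof.
move=> fe; pose F : 'M[C]_n := \matrix_i e i.
have FF : F *m G *m F ^t* = 1%:M.
  apply/matrixP => i j; rewrite !mxE -fe /hdot mxE; apply: eq_bigr => k _.
  rewrite !mxE; congr (_ * _); apply: eq_bigr => l _.
  by rewrite !mxE.
have GF : G *m F ^t* *m F = 1%:M.
  by rewrite -mulmxA in FF; exact: mulmx1C FF.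
rewrite -[LHS]mulmx1 -GF !mulmxA mulmx_sum_row.
apply: eq_bigr => k _; rewrite rowK; congr (_ *: _).
rewrite /hdot !mxE; apply: eq_bigr => l _.
by rewrite !mxE.
Qed.

(** Families indexed by [nat] of which only the first [m] members matter, so
    that extending a family does not change its type. *)
Definition orthonormal_below m (f : nat -> 'rV[C]_n) : Prop :=
  forall i j, (i < m)%N -> (j < m)%N -> hdot (f i) (f j) = (i == j)%:R.

(** Fewer than [n] linear conditions on [n] coordinates have a nonzero common
    solution; normalize it. *)
Lemma orthonormal_below_extend1 m f : (m < n)%N -> orthonormal_below m f ->
  exists2 f', orthonormal_below m.+1 f' & forall i, (i < m)%N -> f' i = f i.
Proof.
move=> mn of_.
pose A : 'M[C]_(n, m) := \matrix_(i, j) (G *m (f j) ^t* ) i 0.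
have /rowV0Pn[X /sub_kermxP XA X0] : kermx A != 0.
  rewrite -mxrank_eq0 mxrank_ker subn_eq0 -ltnNge.
  exact: leq_ltn_trans (rank_leq_col A) mn.
have Xf i : (i < m)%N -> hdot X (f i) = 0.
  move=> im; have /matrixP/(_ 0 (Ordinal im)) := XA; rewrite !mxE => <-.
  rewrite /hdot -mulmxA mxE; apply: eq_bigr => l _.
  by rewrite [in RHS]mxE.
have p0 := G_pos X0.
pose s := (sqrtC (hdot X X))^-1.
have s0 : 0 <= s by rewrite invr_ge0 sqrtC_ge0 ltW.
have sX : hdot (s *: X) (s *: X) = 1.
  rewrite hdotZl hdotZr (CrealP (ger0_real s0)) mulrA -expr2 exprVn sqrtCK.
  by rewrite mulVf// gt_eqF.
exists (fun i => if i == m then s *: X else f i); last first.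
  by move=> i im; rewrite ltn_eqF.
move=> i j; rewrite !ltnS (leq_eqVlt i) (leq_eqVlt j).
case: (eqVneq i m) => [->|im] /=; case: (eqVneq j m) => [->|jm] //=.
- by move=> _ jm'; rewrite hdotZl Xf ?mulr0.
- by move=> im' _; rewrite hdotZr -hdot_conj Xf// conjC0 mulr0 (negbTE im).
- exact: of_.
Qed.

Lemma orthonormal_below_extend m f : (m <= n)%N -> orthonormal_below m f ->
  exists2 e, orthonormal_frame e & forall i : 'I_n, (i < m)%N -> e i = f i.
Proof.
move=> mn; move Ek : (n - m)%N => k.
elim: k m mn Ek f => [|k IH] m mn Ek f of_.
  have nm : (n <= m)%N by rewrite -subn_eq0 Ek.
  exists (fun i => f i) => // i j; apply: of_; exact: leq_trans (ltn_ord _) nm.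
have mn' : (m < n)%N by rewrite -subn_gt0 Ek.
have [f' of' f'f] := orthonormal_below_extend1 mn' of_.
have [|e fe ef'] := IH m.+1 mn' _ f' of'; first by rewrite subnS Ek.
by exists e => // i im; rewrite ef' ?f'f// ltnS ltnW.
Qed.

Lemma frame_exists : exists e, orthonormal_frame e.
Proof.
by have [|e fe _] := @orthonormal_below_extend 0 (fun=> 0) (leq0n _); [|exists e].
Qed.

Lemma unit_in_frame X : (0 < n)%N -> hdot X X = 1 ->
  exists e i, orthonormal_frame e /\ e i = X.
Proof.
move=> n0 X1; have [|e fe eX] := @orthonormal_below_extend 1 (fun=> X) n0.
  by case=> // -[].
by exists e, (Ordinal n0); split=> //; exact: eX.
Qed.

Lemma pair_in_frame X Y : (1 < n)%N ->
  hdot X X = 1 -> hdot Y Y = 1 -> hdot X Y = 0 ->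
  exists e i j, [/\ orthonormal_frame e, i != j, e i = X & e j = Y].
Proof.
move=> n1 X1 Y1 XY; have YX : hdot Y X = 0 by rewrite -hdot_conj XY conjC0.
have [|e fe eXY] := @orthonormal_below_extend 2 (nth 0 [:: X; Y]) n1.
  by case=> [|[|//]] [|[|//]].
by exists e, (Ordinal (ltnW n1)), (Ordinal n1); split=> //; exact: eXY.
Qed.

(** Ricci and scalar curvature are such traces, hence do not depend on the
    frame. *)
Lemma sesquilinear_trace (b : 'rV[C]_n -> 'rV[C]_n -> C) e f :
  (forall a X X' Y, b (a *: X + X') Y = a * b X Y + b X' Y) ->
  (forall a X Y Y', b X (a *: Y + Y') = a^* * b X Y + b X Y') ->
  orthonormal_frame e -> orthonormal_frame f ->
  \sum_i b (e i) (e i) = \sum_i b (f i) (f i).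
Proof.
move=> bl br fe ff.
have b0l Y : b 0 Y = 0 by have := bl (-1) 0 0 Y; rewrite scaler0 addr0 mulN1r addNr.
have b0r X : b X 0 = 0.
  by have := br (-1) X 0 0; rewrite scaler0 addr0 rmorphN1 mulN1r addNr.
have bsuml (c : 'I_n -> C) (x : 'I_n -> 'rV[C]_n) Y :
    b (\sum_i c i *: x i) Y = \sum_i c i * b (x i) Y.
  by elim/big_rec2: _ => // i u v _ <-; rewrite bl.
have bsumr (c : 'I_n -> C) (x : 'I_n -> 'rV[C]_n) X :
    b X (\sum_i c i *: x i) = \sum_i (c i)^* * b X (x i).
  by elim/big_rec2: _ => // i u v _ <-; rewrite br.
have parseval k l : \sum_i hdot (e i) (f k) * (hdot (e i) (f l))^* = (l == k)%:R.
  rewrite -ff [in RHS](frame_expand (f l) fe).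
  have hsuml (c : 'I_n -> C) (x : 'I_n -> 'rV[C]_n) Y :
      hdot (\sum_i c i *: x i) Y = \sum_i c i * hdot (x i) Y.
    by elim/big_rec2: _ => [|i u v _ <-]; rewrite ?hdotDl ?hdotZl// /hdot !mul0mx mxE.
  by rewrite hsuml; apply: eq_bigr => i _; rewrite hdot_conj mulrC.
transitivity (\sum_i \sum_k \sum_l
    (hdot (e i) (f k) * (hdot (e i) (f l))^* ) * b (f k) (f l)).
  apply: eq_bigr => i _.
  rewrite {1}(frame_expand (e i) ff) bsuml; apply: eq_bigr => k _.
  rewrite (congr1 (b (f k)) (frame_expand (e i) ff)) bsumr mulr_sumr.
  by apply: eq_bigr => l _; rewrite mulrA.
rewrite exchange_big; apply: eq_bigr => k _ /=.
rewrite exchange_big /= (bigD1 k)//= -mulr_suml parseval eqxx mul1r.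
rewrite big1 ?addr0// => l lk.
by rewrite -mulr_suml parseval (negbTE lk) mul0r.
Qed.
End HermitianFrames.

(** * Algebra of Kaehler curvature forms *)

Section CurvatureForms.
Variables (C : numClosedFieldType) (n : nat).
Local Notation V := 'rV[C]_n.

(** Linearity in [Z], conjugate-linearity in [Y] and [W] and the symmetry in
    [Y] and [W] follow from the three clauses. *)
Definition kahler_form (r : V -> V -> V -> V -> C) : Prop :=
  [/\ forall a X X' Y Z W, r (a *: X + X') Y Z W = a * r X Y Z W + r X' Y Z W,
      forall X Y Z W, r X Y Z W = r Z Y X W &
      forall X Y Z W, (r X Y Z W)^* = r Y X W Z].

Variables (r : V -> V -> V -> V -> C) (kr : kahler_form r).

Lemma rL a X X' Y Z W : r (a *: X + X') Y Z W = a * r X Y Z W + r X' Y Z W.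
Proof. by case: kr. Qed.

Lemma r_sym13 X Y Z W : r X Y Z W = r Z Y X W.
Proof. by case: kr. Qed.

Lemma r_conj X Y Z W : (r X Y Z W)^* = r Y X W Z.
Proof. by case: kr. Qed.

Lemma r_sym24 X Y Z W : r X Y Z W = r X W Z Y.
Proof. by rewrite -r_conj r_sym13 r_conj. Qed.

Lemma r_swap X Y Z W : r X Y Z W = r Z W X Y.
Proof. by rewrite r_sym13 r_sym24. Qed.

Lemma rD1 X X' Y Z W : r (X + X') Y Z W = r X Y Z W + r X' Y Z W.
Proof. by rewrite -[X]scale1r rL mul1r scale1r. Qed.

Lemma rD3 X Y Z Z' W : r X Y (Z + Z') W = r X Y Z W + r X Y Z' W.
Proof. by rewrite !(r_sym13 X) rD1. Qed.

Lemma rD2 X Y Y' Z W : r X (Y + Y') Z W = r X Y Z W + r X Y' Z W.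
Proof. by rewrite -r_conj rD1 rmorphD /= !r_conj. Qed.

Lemma rD4 X Y Z W W' : r X Y Z (W + W') = r X Y Z W + r X Y Z W'.
Proof. by rewrite !(r_sym24 X Y) rD2. Qed.

Lemma rZ1 a X Y Z W : r (a *: X) Y Z W = a * r X Y Z W.
Proof.
have r0 : r 0 Y Z W = 0.
  by have := rL (-1) 0 0 Y Z W; rewrite scaler0 addr0 mulN1r addNr.
by rewrite -[a *: X]addr0 rL r0 addr0.
Qed.

Lemma rZ3 a X Y Z W : r X Y (a *: Z) W = a * r X Y Z W.
Proof. by rewrite !(r_sym13 X) rZ1. Qed.

Lemma rZ2 a X Y Z W : r X (a *: Y) Z W = a^* * r X Y Z W.
Proof. by rewrite -r_conj rZ1 rmorphM /= !r_conj. Qed.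

Lemma rZ4 a X Y Z W : r X Y Z (a *: W) = a^* * r X Y Z W.
Proof. by rewrite !(r_sym24 X Y) rZ2. Qed.

Definition rD := (rD1, rD2, rD3, rD4).
Definition rZ := (rZ1, rZ2, rZ3, rZ4).

(** In the four-linear expansion, the terms of odd degree in [Y] cancel and the
    symmetries identify the four terms of bisectional type. *)
Lemma hsc_polarization X Y :
  r (X + Y) (X + Y) (X + Y) (X + Y) +
  r (X + -1 *: Y) (X + -1 *: Y) (X + -1 *: Y) (X + -1 *: Y) =
  2 * (r X X X X + r Y Y Y Y + 4 * r X X Y Y + r X Y X Y + r Y X Y X).
Proof.
rewrite !rD !rZ rmorphN1.
rewrite (r_sym13 Y X X X) (r_sym24 X Y X X) (r_sym13 Y Y X X) (r_sym24 X Y Y X).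
rewrite (r_sym13 Y X X Y) (r_sym13 X Y Y Y) (r_sym24 Y X Y Y).
by ring.
Qed.

(** Replacing [Y] by [i Y] preserves the bisectional curvature and reverses the
    sign of r X Y X Y, which isolates the former after addition. *)
Lemma bisectional_iR X Y : r X X ('i *: Y) ('i *: Y) = r X X Y Y.
Proof. by rewrite !rZ conjCi mulrA mulrN -expr2 sqrCi opprK mul1r. Qed.

Lemma anti_iR X Y : r X ('i *: Y) X ('i *: Y) = - r X Y X Y.
Proof. by rewrite !rZ conjCi mulrA mulrNN -expr2 sqrCi mulN1r. Qed.

Lemma anti_iL X Y : r ('i *: Y) X ('i *: Y) X = - r Y X Y X.
Proof. by rewrite !rZ mulrA -expr2 sqrCi mulN1r. Qed.

Lemma hsc_polarization4 X Y :
  let iY := 'i *: Y in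
  r (X + Y) (X + Y) (X + Y) (X + Y) +
  r (X + -1 *: Y) (X + -1 *: Y) (X + -1 *: Y) (X + -1 *: Y) +
  (r (X + iY) (X + iY) (X + iY) (X + iY) +
  r (X + -1 *: iY) (X + -1 *: iY) (X + -1 *: iY) (X + -1 *: iY)) =
  4 * (r X X X X + r Y Y Y Y + 4 * r X X Y Y).
Proof.
rewrite /= !hsc_polarization (bisectional_iR X) (anti_iR X) (anti_iL X).
by rewrite (bisectional_iR ('i *: Y)) (r_swap ('i *: Y)) bisectional_iR; ring.
Qed.

(** The value on the rotated pair X + Y, X - Y of the quadratic form in
    xi = (1, -1) that [qobc_pair_frame] bounds. *)
Lemma rotated_pair X Y :
  let P := X + Y in let N := X + -1 *: Y in
  r P P P P + r N N N N - 2 * r P P N N =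
  4 * (2 * r X X Y Y + r X Y X Y + r Y X Y X).
Proof.
move=> P N; rewrite hsc_polarization /P /N !rD !rZ rmorphN1.
rewrite (r_sym13 Y X X X) (r_sym24 X Y X X) (r_sym13 Y Y X X) (r_sym24 X Y Y X).
rewrite (r_sym13 Y X X Y) (r_sym13 X Y Y Y) (r_sym24 Y X Y Y).
by ring.
Qed.

(** Polarization twice: [hsc_polarization4] passes from the diagonal to the
    bisectional curvatures, then a sesquilinear form over the complex numbers
    vanishes if it does on the diagonal. *)
Lemma hsc0_flat : (forall X, r X X X X = 0) -> forall X Y Z W, r X Y Z W = 0.
Proof.
move=> h0.
have sesq0 (b : V -> V -> C) :
    (forall a X X' Y, b (a *: X + X') Y = a * b X Y + b X' Y) ->
    (forall a X Y Y', b X (a *: Y + Y') = a^* * b X Y + b X Y') ->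
    (forall X, b X X = 0) -> forall X Y, b X Y = 0.
  move=> bl br b0 X Y.
  have E1 := b0 (1 *: X + Y); have E2 := b0 ('i *: X + Y).
  rewrite !(bl, br) !b0 conjCi conjC1 in E1 E2.
  have E : 2 * 'i * b X Y = 0.
    have E3 : 'i * (1 * (1 * 0 + b X Y) + (1 * b Y X + 0)) +
        ('i * (- 'i * 0 + b X Y) + (- 'i * b Y X + 0)) = 0.
      by rewrite E1 E2 mulr0 addr0.
    by rewrite -[RHS]E3; ring.
  apply/eqP; move/eqP: E; rewrite !mulf_eq0 pnatr_eq0 /=.
  by rewrite (negbTE (neq0Ci C)).
have diag X Y : r X X Y Y = 0.
  have := hsc_polarization4 X Y; rewrite /= !h0 !addr0 add0r => /esym/eqP.
  by rewrite !mulf_eq0 !pnatr_eq0 /= => /eqP.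
move=> X Y Z W.
apply: (sesq0 (fun X Y => r X Y Z W)) => [a x x' y|a x y y'|x].
- by rewrite rD1 rZ1.
- by rewrite rD2 rZ2.
apply: (sesq0 (fun Z W => r x x Z W)) => [a z z' w|a z w w'|z].
- by rewrite rD3 rZ3.
- by rewrite rD4 rZ4.
exact: diag.
Qed.
End CurvatureForms.

(** * Consequences of nonnegative quadratic orthogonal bisectional curvature *)

Lemma weighted_gap_sum (C : comPzRingType) (n : nat) (m : 'I_n -> 'I_n -> C)
    (xi : 'I_n -> C) : (forall i j, m i j = m j i) ->
  \sum_i \sum_j m i j * (xi i - xi j) ^+ 2 =
  2 * (\sum_i xi i ^+ 2 * \sum_j m i j - \sum_i \sum_j m i j * xi i * xi j).
Proof.
move=> m_sym; pose A := \sum_i \sum_j m i j * xi i ^+ 2.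
have A' : \sum_i \sum_j m i j * xi j ^+ 2 = A.
  by rewrite exchange_big; apply: eq_bigr => i _; apply: eq_bigr => j _; rewrite m_sym.
have -> : \sum_i xi i ^+ 2 * \sum_j m i j = A.
  by apply: eq_bigr => i _; rewrite mulr_sumr; apply: eq_bigr => j _; rewrite mulrC.
have -> : 2 * (A - \sum_i \sum_j m i j * xi i * xi j) =
    A + A - 2 * \sum_i \sum_j m i j * xi i * xi j by ring.
rewrite -{2}A' mulr_sumr -big_split -sumrB; apply: eq_bigr => i _ /=.
rewrite mulr_sumr -big_split -sumrB; apply: eq_bigr => j _ /=; ring.
Qed.

Section QuadraticBisectional.
Variables (C : numClosedFieldType) (n : nat) (G : 'M[C]_n).
Local Notation V := 'rV[C]_n.
Hypothesis G_conj : forall i j, (G i j)^* = G j i.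
Hypothesis G_pos : forall X, X != 0 -> 0 < hdot G X X.
Hypothesis n_gt1 : (1 < n)%N.
Variables (r : V -> V -> V -> V -> C) (kr : kahler_form r).

Definition ricci (e : 'I_n -> V) (X : V) : C := \sum_j r X X (e j) (e j).

Definition scal (e : 'I_n -> V) : C := \sum_i ricci e (e i).

(** Real weights are elements of [C] that happen to be real, since [C] comes
    with no separate field of real numbers. *)
Definition qobc_ge0 : Prop := forall (e : 'I_n -> V) (xi : 'I_n -> C),
  orthonormal_frame G e -> (forall i, xi i \is Num.real) ->
  0 <= \sum_i \sum_j r (e i) (e i) (e j) (e j) * (xi i - xi j) ^+ 2.

Definition orthonormal_pair X Y : Prop :=
  [/\ hdot G X X = 1, hdot G Y Y = 1 & hdot G X Y = 0].

Lemma ricci_frame e f X : orthonormal_frame G e -> orthonormal_frame G f ->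
  ricci e X = ricci f X.
Proof.
move=> fe ff; apply: (sesquilinear_trace G_conj (b := r X X)) => // [a Z Z' W|a Z W W'].
- by rewrite (rD3 kr) (rZ3 kr).
- by rewrite (rD4 kr) (rZ4 kr).
Qed.

Lemma scal_frame e f : orthonormal_frame G e -> orthonormal_frame G f ->
  scal e = scal f.
Proof.
move=> fe ff; transitivity (\sum_i ricci e (f i)); last first.
  by apply: eq_bigr => i _; exact: ricci_frame.
apply: (sesquilinear_trace G_conj (b := fun X Y => \sum_j r X Y (e j) (e j)))
  => // [a X X' Y|a X Y Y'].
- by rewrite mulr_sumr -big_split; apply: eq_bigr => j _; rewrite (rD1 kr) (rZ1 kr).
- by rewrite mulr_sumr -big_split; apply: eq_bigr => j _; rewrite (rD2 kr) (rZ2 kr).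
Qed.

Lemma ricci_parallelogram e X Y :
  ricci e (X + Y) + ricci e (X + -1 *: Y) = 2 * (ricci e X + ricci e Y).
Proof.
rewrite -!big_split mulr_sumr; apply: eq_bigr => j _ /=.
rewrite !(rD1 kr, rD2 kr, rZ1 kr, rZ2 kr) rmorphN1; ring.
Qed.

Lemma qobc_frame e xi : qobc_ge0 -> orthonormal_frame G e ->
  (forall i, xi i \is Num.real) ->
  \sum_i \sum_j r (e i) (e i) (e j) (e j) * xi i * xi j <=
  \sum_i xi i ^+ 2 * ricci e (e i).
Proof.
move=> q fe xr; have := q e xi fe xr.
rewrite (weighted_gap_sum (m := fun i j => r (e i) (e i) (e j) (e j))).
  by rewrite pmulr_rge0 ?ltr0n// subr_ge0.
by move=> i j; rewrite (r_swap kr).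
Qed.

(** The weights are concentrated on [e i]. *)
Lemma hsc_le_ricci_frame e i : qobc_ge0 -> orthonormal_frame G e ->
  r (e i) (e i) (e i) (e i) <= ricci e (e i).
Proof.
move=> q fe; have := qobc_frame (xi := fun k => (k == i)%:R) q fe.
move=> /(_ (fun k => realn C _)).
have one (F : 'I_n -> C) : (forall k, k != i -> F k = 0) -> \sum_k F k = F i.
  by move=> F0; rewrite (bigD1 i)//= big1 ?addr0.
rewrite one => [|k /negbTE ki]; last by apply: big1 => l _; rewrite ki mulr0 mul0r.
rewrite one => [|k /negbTE ki]; last by rewrite ki mulr0.
rewrite one => [|k /negbTE ki]; last by rewrite ki expr0n mul0r.
by rewrite eqxx !mulr1 expr1n mul1r.
Qed.

(** The weights are 1 on [e i] and -1 on [e j]. *)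
Lemma qobc_pair_frame e i j : qobc_ge0 -> orthonormal_frame G e -> i != j ->
  r (e i) (e i) (e i) (e i) + r (e j) (e j) (e j) (e j)
    - 2 * r (e i) (e i) (e j) (e j) <= ricci e (e i) + ricci e (e j).
Proof.
move=> q fe ij; pose xi k : C := (k == i)%:R - (k == j)%:R.
have := qobc_frame (xi := xi) q fe; have ji : j != i by rewrite eq_sym.
have xi0 k : k != i -> k != j -> xi k = 0.
  by move=> /negbTE ki /negbTE kj; rewrite /xi ki kj subrr.
have xii : xi i = 1 by rewrite /xi eqxx (negbTE ij) subr0.
have xij : xi j = -1 by rewrite /xi eqxx (negbTE ji) sub0r.
move=> /(_ (fun k => rpredB (realn C _) (realn C _))).
have two (F : 'I_n -> C) : (forall k, k != i -> k != j -> F k = 0) ->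
    \sum_k F k = F i + F j.
  move=> F0; rewrite (bigD1 i)// (bigD1 j)//= big1 ?addr0// => k /andP[]; exact: F0.
rewrite two => [|k ki kj]; last first.
  by apply: big1 => l _; rewrite xi0// mulr0 mul0r.
rewrite two => [|k ki kj]; last by rewrite (xi0 k)// mulr0.
rewrite two => [|k ki kj]; last by rewrite (xi0 k)// mulr0.
rewrite two => [|k ki kj]; last by rewrite (xi0 k)// expr0n mul0r.
rewrite xii xij !mulr1 !mulrN1 opprK expr1n sqrrN expr1n !mul1r (r_swap kr (e j) (e j) (e i)).
apply: le_trans; rewrite le_eqVlt; apply/orP; left; apply/eqP; ring.
Qed.

(** Rescaling by [rsqrt2] turns the sum and the difference of an orthonormal
    pair into an orthonormal pair. *)
Definition rsqrt2 : C := (sqrtC 2)^-1.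

Lemma rsqrt2_normsq : rsqrt2 * rsqrt2^* = 2^-1.
Proof.
rewrite (CrealP (ger0_real _)) ?invr_ge0 ?sqrtC_ge0 ?ler0n//.
by rewrite -expr2 exprVn sqrtCK.
Qed.

Lemma hdot_rsqrt2 X Y : hdot G (rsqrt2 *: X) (rsqrt2 *: Y) = 2^-1 * hdot G X Y.
Proof. by rewrite hdotZl hdotZr// mulrA rsqrt2_normsq. Qed.

Lemma bisectional_rsqrt2 X Y :
  r (rsqrt2 *: X) (rsqrt2 *: X) (rsqrt2 *: Y) (rsqrt2 *: Y) =
  2^-1 ^+ 2 * r X X Y Y.
Proof. by rewrite -rsqrt2_normsq !(rZ kr); ring. Qed.

Lemma ricci_rsqrt2 e X : ricci e (rsqrt2 *: X) = 2^-1 * ricci e X.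
Proof.
rewrite mulr_sumr; apply: eq_bigr => k _.
by rewrite (rZ1 kr) (rZ2 kr) mulrA rsqrt2_normsq.
Qed.

Lemma orthonormal_pair_rotate X Y : orthonormal_pair X Y ->
  orthonormal_pair (rsqrt2 *: (X + Y)) (rsqrt2 *: (X + -1 *: Y)).
Proof.
move=> [X1 Y1 XY]; have YX : hdot G Y X = 0 by rewrite -hdot_conj// XY conjC0.
split; rewrite hdot_rsqrt2 !hdotDl !hdotDr// ?hdotZl ?hdotZr// X1 Y1 XY YX.
- by field.
- by rewrite rmorphN1; field.
- by rewrite rmorphN1; ring.
Qed.

Lemma orthonormal_pair_iR X Y : orthonormal_pair X Y -> orthonormal_pair X ('i *: Y).
Proof.
move=> [X1 Y1 X0].
have ii : ('i : C) * 'i^* = 1 by rewrite conjCi mulrN -expr2 sqrCi opprK.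
by split; rewrite ?hdotZl ?hdotZr// ?X0 ?mulr0// Y1 mulr1.
Qed.

Lemma ricci_iR e X : ricci e ('i *: X) = ricci e X.
Proof.
apply: eq_bigr => j _.
by rewrite (rZ1 kr) (rZ2 kr) mulrA conjCi mulrN -expr2 sqrCi opprK mul1r.
Qed.

(** [qobc_pair_frame] in a frame through (X + Y)/sqrt 2 and (X - Y)/sqrt 2; the
    Ricci terms are unchanged by the rotation, by the parallelogram law. *)
Lemma qobc_pair X Y e : qobc_ge0 -> orthonormal_frame G e -> orthonormal_pair X Y ->
  2 * r X X Y Y + r X Y X Y + r Y X Y X <= ricci e X + ricci e Y.
Proof.
move=> q fe XY; have [P1 N1 PN] := orthonormal_pair_rotate XY.
have [f [i [j [ff ij fi fj]]]] := pair_in_frame G_conj G_pos n_gt1 P1 N1 PN.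
have := qobc_pair_frame q ff ij; rewrite fi fj !bisectional_rsqrt2 !ricci_rsqrt2.
rewrite -[X in _ <= X]mulrDr ricci_parallelogram !(ricci_frame _ ff fe).
rewrite mulKf ?pnatr_eq0//; apply: le_trans.
set P := X + Y; set N := X + -1 *: Y.
rewrite [X in _ <= X](_ : _ =
  (2^-1) ^+ 2 * (r P P P P + r N N N N - 2 * r P P N N)); last by ring.
rewrite (rotated_pair kr) le_eqVlt; apply/orP; left; apply/eqP.
by field.
Qed.

(** Average of [qobc_pair] over the pairs X, Y and X, i Y. *)
Lemma bisectional_le_ricci X Y e : qobc_ge0 -> orthonormal_frame G e ->
  orthonormal_pair X Y -> 2 * r X X Y Y <= ricci e X + ricci e Y.
Proof.
move=> q fe XY; have XiY := orthonormal_pair_iR XY.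
have h1 := qobc_pair q fe XY; have h2 := qobc_pair q fe XiY.
have := lerD h1 h2.
rewrite (bisectional_iR kr) (anti_iR kr) (anti_iL kr) ricci_iR.
rewrite [X in X <= _ -> _](_ : _ = 2 * (2 * r X X Y Y)); last by ring.
by rewrite -mulr2n -[X in _ <= X -> _]mulr_natl ler_pM2l ?ltr0n.
Qed.

Lemma bisectional_defect_ge0 e i : qobc_ge0 -> orthonormal_frame G e ->
  0 <= ricci e (e i) - r (e i) (e i) (e i) (e i).
Proof. by move=> q fe; rewrite subr_ge0; exact: hsc_le_ricci_frame. Qed.

(** The sum of [bisectional_le_ricci] over all pairs of distinct vectors of the
    frame: the Ricci terms add up to 2 (n - 1) S, where S = [scal e], and the
    bisectional curvatures of distinct vectors to the left-hand side. *)
Lemma defect_le_scal e : qobc_ge0 -> orthonormal_frame G e ->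
  \sum_i (ricci e (e i) - r (e i) (e i) (e i) (e i)) <= (n%:R - 1) * scal e.
Proof.
move=> q fe; set o := \sum_i _.
(* The last term of [F] cancels the diagonal, so that sums range over all [j]. *)
pose F i j := ricci e (e i) + ricci e (e j) - 2 * r (e i) (e i) (e j) (e j)
  - (i == j)%:R * (2 * (ricci e (e i) - r (e i) (e i) (e i) (e i))).
have F0 i j : 0 <= F i j.
  rewrite /F; have [<-|ij] := eqVneq i j.
    by rewrite mul1r le_eqVlt; apply/orP; left; apply/eqP; ring.
  rewrite mul0r subr0 subr_ge0; apply: bisectional_le_ricci => //.
  by split; rewrite fe ?eqxx// (negbTE ij).
have : 0 <= \sum_i \sum_j F i j by apply: sumr_ge0 => i _; apply: sumr_ge0 => j _.
have -> : \sum_i \sum_j F i j = 2 * ((n%:R - 1) * scal e - o).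
  transitivity (\sum_i (n%:R * ricci e (e i) + scal e - 2 * ricci e (e i)
      - 2 * (ricci e (e i) - r (e i) (e i) (e i) (e i)))).
    apply: eq_bigr => i _; rewrite /F !(sumrB, big_split) /=.
    rewrite sumr_const card_ord -[_ *+ n]mulr_natl -mulr_sumr; congr (_ - _).
    rewrite (bigD1 i)//= eqxx mul1r big1 ?addr0// => j ji.
    by rewrite eq_sym (negbTE ji) mul0r.
  rewrite !(sumrB, big_split) /= -!mulr_sumr sumr_const card_ord -[_ *+ n]mulr_natl.
  rewrite -/(scal e) sumrB -/(scal e) /o sumrB -/(scal e); ring.
by rewrite pmulr_rge0 ?ltr0n// subr_ge0.
Qed.

Let n1_gt0 : 0 < (n%:R - 1 : C).
Proof. by rewrite subr_gt0 ltr1n. Qed.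

Lemma scal_ge0 e : qobc_ge0 -> orthonormal_frame G e -> 0 <= scal e.
Proof.
move=> q fe; rewrite -(pmulr_rge0 _ n1_gt0).
apply: le_trans (defect_le_scal q fe); apply: sumr_ge0 => i _.
exact: bisectional_defect_ge0.
Qed.

(** All defects of a frame through [X] are nonnegative with a nonpositive sum. *)
Lemma hsc_eq_ricci e X : qobc_ge0 -> orthonormal_frame G e -> scal e = 0 ->
  hdot G X X = 1 -> r X X X X = ricci e X.
Proof.
move=> q fe s0 X1.
have [f [i [ff <-]]] := unit_in_frame G_conj G_pos (ltnW n_gt1) X1.
have d0 : \sum_i (ricci f (f i) - r (f i) (f i) (f i) (f i)) = 0.
  apply/le_anti; rewrite (le_trans (defect_le_scal q ff)) /=.
    by apply: sumr_ge0 => k _; exact: bisectional_defect_ge0.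
  by rewrite (scal_frame ff fe) s0 mulr0.
move/eqP: d0; rewrite psumr_eq0; last by move=> k _; exact: bisectional_defect_ge0.
move=> /allP/(_ i (mem_index_enum i)) /=; rewrite subr_eq0 => /eqP <-.
exact: ricci_frame.
Qed.

(** Apply H = Ric to the rotations of the pairs X, Y and X, i Y and add: the
    polarization formula brings in 4 B(X, Y) against the Ricci terms. *)
Lemma bisectional_eq_ricci e X Y : qobc_ge0 -> orthonormal_frame G e ->
  scal e = 0 -> orthonormal_pair X Y ->
  4 * r X X Y Y = ricci e X + ricci e Y.
Proof.
move=> q fe s0.
have two0 : (2 : C) != 0 by rewrite pnatr_eq0.
have rotated A B : orthonormal_pair A B ->
    r A A A A + r B B B B + 4 * r A A B B + r A B A B + r B A B A =
    2 * (ricci e A + ricci e B).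
  move=> AB; have [P1 N1 _] := orthonormal_pair_rotate AB.
  have hP := hsc_eq_ricci q fe s0 P1; have hN := hsc_eq_ricci q fe s0 N1.
  apply: (mulfI two0); rewrite -(hsc_polarization kr) -ricci_parallelogram.
  apply: (mulfI (expf_neq0 2 (invr_neq0 two0))).
  rewrite mulrDr -!bisectional_rsqrt2 hP hN !ricci_rsqrt2.
  by field.
move=> XY; have XiY := orthonormal_pair_iR XY; have [X1 Y1 _] := XY.
have h1 := rotated _ _ XY; have h2 := rotated _ _ XiY.
move: h1 h2; rewrite (bisectional_iR kr X) (anti_iR kr X) (anti_iL kr X) ricci_iR.
rewrite (bisectional_iR kr ('i *: Y)) (r_swap kr ('i *: Y)) (bisectional_iR kr Y).
rewrite (hsc_eq_ricci q fe s0 X1) (hsc_eq_ricci q fe s0 Y1) => h1 h2.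
apply: (mulfI two0).
set A := ricci e X in h1 h2 *; set B := ricci e Y in h1 h2 *.
have -> : 2 * (4 * r X X Y Y) = A + B + 4 * r X X Y Y + r X Y X Y + r Y X Y X +
  (A + B + 4 * r X X Y Y + - r X Y X Y + - r Y X Y X) - 2 * (A + B) by ring.
by rewrite h1 h2; ring.
Qed.

(** In a frame through [X], Ric(X) = H(X) says that the bisectional curvatures
    B(X, e_j) with e_j other than X sum to 0; replace each of them by its value
    from [bisectional_eq_ricci] and use that the scalar curvature vanishes. *)
Lemma ricci_scaled_eq0 e X : qobc_ge0 -> orthonormal_frame G e -> scal e = 0 ->
  hdot G X X = 1 -> (n%:R - 2) * ricci e X = 0.
Proof.
move=> q fe s0 X1.
have [f [i [ff fi]]] := unit_in_frame G_conj G_pos (ltnW n_gt1) X1.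
have sf : scal f = 0 by rewrite (scal_frame ff fe).
rewrite (ricci_frame _ fe ff) -fi.
have fi1 : hdot G (f i) (f i) = 1 by rewrite fi.
have off : \sum_(j | j != i) 4 * r (f i) (f i) (f j) (f j) = 0.
  have := hsc_eq_ricci q ff sf fi1; rewrite {1}/ricci (bigD1 i)//= => E.
  rewrite -mulr_sumr; apply/eqP; rewrite mulf_eq0; apply/orP; right; apply/eqP.
  by apply: (addrI (r (f i) (f i) (f i) (f i))); rewrite -E addr0.
rewrite -[RHS]off.
have rest : \sum_(j | j != i) ricci f (f j) = - ricci f (f i).
  by apply: (addrI (ricci f (f i))); rewrite subrr -[RHS]sf /scal [RHS](bigD1 i).
transitivity (\sum_(j | j != i) (ricci f (f i) + ricci f (f j))).
  rewrite big_split /= rest sumr_const cardC1 card_ord -[_ *+ n.-1]mulr_natl.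
  have -> : (n.-1)%:R = n%:R - 1 :> C by rewrite -subn1 natrB// ltnW.
  by ring.
apply: eq_bigr => j ji; rewrite -(bisectional_eq_ricci q ff sf)//.
by split; rewrite ff ?eqxx// eq_sym (negbTE ji).
Qed.

Lemma ricci_eq0 e X : (2 < n)%N -> qobc_ge0 -> orthonormal_frame G e ->
  scal e = 0 -> hdot G X X = 1 -> ricci e X = 0.
Proof.
move=> n2 q fe s0 X1; have /eqP := ricci_scaled_eq0 q fe s0 X1.
by rewrite mulf_eq0 subr_eq0 eqr_nat gtn_eqF// => /eqP.
Qed.

(** For n = 2 the left-hand side is the scalar curvature itself. *)
Lemma ricci_sum_eq0 e X Y : qobc_ge0 -> orthonormal_frame G e -> scal e = 0 ->
  orthonormal_pair X Y -> ricci e X + ricci e Y = 0.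
Proof.
move=> q fe s0 [X1 Y1 XY]; have [n2|n2] := ltnP 2 n.
  by rewrite !ricci_eq0 ?addr0.
have [f [i [j [ff ij <- <-]]]] := pair_in_frame G_conj G_pos n_gt1 X1 Y1 XY.
rewrite -s0 (scal_frame fe ff) !(ricci_frame _ fe ff) /scal (bigD1 i)// (bigD1 j)/=.
  rewrite big1 ?addr0// => k /andP[]; move: ij; rewrite -!val_eqE /=.
  by have := ltn_ord i; have := ltn_ord j; have := ltn_ord k; lia.
by rewrite eq_sym.
Qed.

Lemma scal_eq0P e : qobc_ge0 -> orthonormal_frame G e ->
  scal e = 0 <-> forall X Y, orthonormal_pair X Y ->
    r X X Y Y = 0 /\ r X X X X + r Y Y Y Y = 0.
Proof.
move=> q fe; split=> [s0 X Y XY|h].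
  have ric0 := ricci_sum_eq0 q fe s0 XY; have [X1 Y1 _] := XY.
  split; last by rewrite !(hsc_eq_ricci q fe s0).
  by apply/eqP; have /eqP := bisectional_eq_ricci q fe s0 XY; rewrite ric0 mulf_eq0 pnatr_eq0.
have pij i j : i != j -> orthonormal_pair (e i) (e j).
  by move=> /negbTE ij; split; rewrite fe ?eqxx ?ij.
pose H i := r (e i) (e i) (e i) (e i).
(* Only the diagonal survives in [scal e]; it vanishes since its entries cancel
   in pairs and there are at least two of them. *)
have -> : scal e = \sum_i H i.
  apply: eq_bigr => i _; rewrite /ricci (bigD1 i)//= big1 ?addr0// => j ji.
  by have [] := h _ _ (pij i j _); first by rewrite eq_sym.
have : \sum_i \sum_j (H i + H j - (i == j)%:R * (2 * H i)) = 0.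
  apply: big1 => i _; apply: big1 => j _; have [<-|ij] := eqVneq i j.
    by rewrite mul1r; ring.
  by rewrite mul0r subr0; have [] := h _ _ (pij i j ij).
have -> : \sum_i \sum_j (H i + H j - (i == j)%:R * (2 * H i)) =
    2 * ((n%:R - 1) * \sum_i H i).
  transitivity (\sum_i (n%:R * H i + \sum_j H j - 2 * H i)).
    apply: eq_bigr => i _; rewrite !(sumrB, big_split) /=.
    rewrite sumr_const card_ord -[_ *+ n]mulr_natl; congr (_ - _).
    rewrite (bigD1 i)//= eqxx mul1r big1 ?addr0// => j ji.
    by rewrite eq_sym (negbTE ji) mul0r.
  rewrite !(sumrB, big_split) /= -!mulr_sumr sumr_const card_ord -[_ *+ n]mulr_natl.
  by ring.
by move=> /eqP; rewrite !mulf_eq0 pnatr_eq0 (gt_eqF n1_gt0) /= => /eqP.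
Qed.

Lemma scal_eq0_flat e : (2 < n)%N -> qobc_ge0 -> orthonormal_frame G e ->
  scal e = 0 -> forall X Y Z W, r X Y Z W = 0.
Proof.
move=> n2 q fe s0; apply: (hsc0_flat kr) => X.
have [->|X0] := eqVneq X 0.
  by rewrite -[X in r X](scale0r 0) (rZ1 kr) mul0r.
have p0 := G_pos X0; pose s := sqrtC (hdot G X X).
have s_real : s^* = s by apply/CrealP/ger0_real; rewrite sqrtC_ge0 ltW.
have s_neq0 : s != 0 by rewrite sqrtC_eq0 gt_eqF.
have [Z -> Z1] : exists2 Z, X = s *: Z & hdot G Z Z = 1.
  exists (s^-1 *: X); first by rewrite scalerKV.
  by rewrite hdotZl hdotZr// fmorphV /= s_real mulrA -expr2 exprVn sqrtCK mulVf// gt_eqF.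
by rewrite !(rZ kr) (hsc_eq_ricci q fe s0 Z1) (ricci_eq0 n2 q fe s0 Z1) !mulr0.
Qed.
End QuadraticBisectional.

(** * The curvature of a Kaehler metric at a point *)

Lemma kahler_form_opp (C : numClosedFieldType) (n : nat)
    (r : 'rV[C]_n -> 'rV[C]_n -> 'rV[C]_n -> 'rV[C]_n -> C) :
  kahler_form r -> kahler_form (fun X Y Z W => - r X Y Z W).
Proof.
move=> [rl rs rc]; split=> *; first by rewrite rl; ring.
  by rewrite rs.
by rewrite rmorphN /= rc.
Qed.

Lemma scal_opp (C : numClosedFieldType) (n : nat)
    (r : 'rV[C]_n -> 'rV[C]_n -> 'rV[C]_n -> 'rV[C]_n -> C) e :
  scal (fun X Y Z W => - r X Y Z W) e = - scal r e.
Proof.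
by rewrite /scal -sumrN; apply: eq_bigr => i _; rewrite /ricci -sumrN.
Qed.

Section CurvatureAtPoint.
Variables (R : realType) (n : nat) (M : complexManifold R n) (g : kahlerMetric M).
Variables (a : chart_index M) (p : M).
Hypothesis ap : chart_dom a p.

Local Notation G := (g a (chart a p)).
Local Notation r := (curv g a p).

Lemma curv_kahler_form : kahler_form r.
Proof.
split.
- move=> b X X' Y Z W; rewrite /curv mulr_sumr -big_split; apply: eq_bigr => i _ /=.
  rewrite mulr_sumr -big_split; apply: eq_bigr => j _ /=.
  rewrite mulr_sumr -big_split; apply: eq_bigr => k _ /=.
  rewrite mulr_sumr -big_split; apply: eq_bigr => l _ /=.
  rewrite !mxE.
  move: (curv_coef _ _ _ _ _ _ _) => c; move: (_^*) (_^*) => y w.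
  by ring.
- move=> X Y Z W; rewrite /curv.
  transitivity (\sum_(i < n) \sum_(k < n) \sum_(j < n) \sum_(l < n)
      curv_coef g a p i j k l * X 0 i * (Y 0 j)^* * Z 0 k * (W 0 l)^* ).
    by apply: eq_bigr => i _; exact: exchange_big.
  rewrite exchange_big; apply: eq_bigr => k _ /=.
  rewrite exchange_big; apply: eq_bigr => j _; apply: eq_bigr => i _.
  apply: eq_bigr => l _; rewrite (curv_coef_sym g ap).
  move: (curv_coef _ _ _ _ _ _ _) => c; move: (_^* ) (_^* ) => y w.
  by ring.
- have conjM5 (c x y z w : R[i]) :
      (c * x * y^* * z * w^* )^* = c^* * y * x^* * w * z^*.
    by rewrite !rmorphM /= !conjCK; ring.
  have conj_sum (F : 'I_n -> R[i]) : (\sum_i F i)^* = \sum_i (F i)^*.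
    exact: rmorph_sum.
  move=> X Y Z W; rewrite /curv conj_sum [RHS]exchange_big.
  apply: eq_bigr => i _; rewrite conj_sum; apply: eq_bigr => j _.
  rewrite conj_sum [RHS]exchange_big; apply: eq_bigr => k _.
  rewrite conj_sum; apply: eq_bigr => l _.
  by rewrite conjM5 (curv_coef_conj g ap).
Qed.

Lemma metric_conj i j : (G i j)^* = G j i.
Proof. by apply: kmetric_conj; exists p. Qed.

Lemma metric_pos X : X != 0 -> 0 < hdot G X X.
Proof. by move=> X0; exact: kmetric_posdef. Qed.

Lemma scalar_curvatureE e : unitary_frame g a p e ->
  scalar_curvature g a p = scal r e.
Proof.
move=> fe; rewrite /scalar_curvature.
have P : [set s : R[i] | forall e : 'I_n -> 'rV[R[i]]_n, unitary_frame g a p e ->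
    s = \sum_(i < n) \sum_(j < n) r (e i) (e i) (e j) (e j)]%classic (scal r e).
  by move=> f ff; exact: (scal_frame metric_conj curv_kahler_form fe ff).
by have := xgetI 0 P; apply.
Qed.

Lemma QOBC_ge0_form : QOBC_ge0 g a p -> qobc_ge0 G r.
Proof.
move=> q e xi fe xr; have := q e (fun i => complex.Re (xi i)) fe.
rewrite /QOBC_form.
have E i j : r (e i) (e i) (e j) (e j) *
      (((complex.Re (xi i) - complex.Re (xi j)) ^+ 2)%:C)%C =
    r (e i) (e i) (e j) (e j) * (xi i - xi j) ^+ 2.
  by rewrite rmorphXn rmorphB /= !RRe_real.
by under eq_bigr => i _ do under eq_bigr => j _ do rewrite E.
Qed.

Lemma QOBC_le0_form : QOBC_le0 g a p -> qobc_ge0 G (fun X Y Z W => - r X Y Z W).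
Proof.
move=> q e xi fe xr; have := q e (fun i => complex.Re (xi i)) fe.
rewrite /QOBC_form -oppr_ge0 -sumrN.
have E i j : r (e i) (e i) (e j) (e j) *
      (((complex.Re (xi i) - complex.Re (xi j)) ^+ 2)%:C)%C =
    r (e i) (e i) (e j) (e j) * (xi i - xi j) ^+ 2.
  by rewrite rmorphXn rmorphB /= !RRe_real.
under eq_bigr => i _.
  rewrite -sumrN; under eq_bigr => j _ do rewrite E -mulNr.
  over.
by [].
Qed.

End CurvatureAtPoint.

Theorem theorem3p1 (R : realType) (n : nat) (n_ge2 : (2 <= n)%N)
    (M : complexManifold R n) (g : kahlerMetric M) (p : M)
    (a : chart_index M) (ap : chart_dom a p) :
  (QOBC_ge0 g a p -> 0 <= scalar_curvature g a p) /\
  (QOBC_le0 g a p -> scalar_curvature g a p <= 0) /\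
  (QOBC_ge0 g a p \/ QOBC_le0 g a p ->
    (scalar_curvature g a p = 0 <->
      forall V W : 'rV[R[i]]_n, unitary_pair g a p V W ->
        curv g a p V V W W = 0 /\
        curv g a p V V V V + curv g a p W W W W = 0) /\
    ((3 <= n)%N -> scalar_curvature g a p = 0 ->
      (forall V : 'rV[R[i]]_n, curv g a p V V V V = 0) /\
      (forall X Y Z W : 'rV[R[i]]_n, curv g a p X Y Z W = 0))).
Proof.
have Gc := metric_conj g ap; have Gp := metric_pos g ap.
have kr := curv_kahler_form g ap; have kr' := kahler_form_opp kr.
have [e fe] := frame_exists Gc Gp.
rewrite (scalar_curvatureE ap fe); split; last split; last case=> q.
- by move=> /QOBC_ge0_form q; exact: (scal_ge0 Gc Gp n_ge2 kr q fe).
- move=> /QOBC_le0_form q; rewrite -oppr_ge0 -scal_opp.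
  exact: (scal_ge0 Gc Gp n_ge2 kr' q fe).
- have {}q := QOBC_ge0_form q; split.
    exact: (scal_eq0P Gc Gp n_ge2 kr q fe).
  move=> n_ge3 s0; have flat := scal_eq0_flat Gc Gp n_ge2 kr n_ge3 q fe s0.
  by split=> *; exact: flat.
- have {}q := QOBC_le0_form q.
  have s0E : scal (curv g a p) e = 0 <->
      scal (fun X Y Z W => - curv g a p X Y Z W) e = 0.
    by rewrite scal_opp; split=> [->|/eqP]; rewrite ?oppr0// oppr_eq0 => /eqP.
  split.
    rewrite s0E (scal_eq0P Gc Gp n_ge2 kr' q fe).
    by split=> h V W VW; have [h1 h2] := h V W VW; split; apply: oppr_inj;
      rewrite ?opprD ?opprK oppr0 -?opprD // ?opprD.
  move=> n_ge3 /s0E s0.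
  have flat := scal_eq0_flat Gc Gp n_ge2 kr' n_ge3 q fe s0.
  by split=> *; apply: oppr_inj; rewrite flat oppr0.
Qed.
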